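(* Let $n\ge 1$, let $q$ be a prime power, let $G=\mathrm{GL}_n(\mathbb{F}_q)$, and fix a regular elliptic element $c\in G$. For $r,s\ge 0$ let $a_{r,s}(q)$ be the number of pairs $(u,v)\in G\times G$ such that $u\cdot v=c$, $\dim\ker(u-1)=r$ and $\dim\ker(v-1)=s$. Then, as polynomials in $x,y$, \[ \frac{1}{|G|}\sum_{r,s\ge 0} a_{r,s}(q)\,x^r y^s =\frac{(x;q^{-1})_n}{(q;q)_n}+\frac{(y;q^{-1})_n}{(q;q)_n} +\sum_{\substack{0\le t,u\le n-1\\ t+u\le n}} q^{tu-t-u}\, \frac{[n-t-1]!_q\,[n-u-1]!_q}{[n-1]!_q\,[n-t-u]!_q}\cdot\frac{q^n-q^t-q^u+1}{q-1}\cdot \frac{(x;q^{-1})_t}{(q;q)_t}\,\frac{(y;q^{-1})_u}{(q;q)_u}. \]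
   Context: Notation: $(a;q)_m=(1-a)(1-aq)\cdots(1-aq^{m-1})$ (with $(a;q)_0=1$), so $(x;q^{-1})_m=(1-x)(1-xq^{-1})\cdots(1-xq^{-(m-1)})$; $[m]!_q=(q;q)_m/(1-q)^m=\prod_{i=1}^m(1+q+\cdots+q^{i-1})$. Regular elliptic element: choosing an $\mathbb{F}_q$-basis of $\mathbb{F}_{q^n}$ identifies $\mathbb{F}_{q^n}^\times$ with a subgroup of $\mathrm{GL}_n(\mathbb{F}_q)$ (an element $\sigma$ acting by multiplication); a regular elliptic element is the image of some $\sigma\in\mathbb{F}_{q^n}$ with $\mathbb{F}_q[\sigma]=\mathbb{F}_{q^n}$ (equivalently, an element acting irreducibly on $\mathbb{F}_q^n$); when $n=1$ one additionally requires $c\neq 1$, so that $c$ has no nonzero fixed vector. The fixed space dimension of $u$ is $\dim_{\mathbb{F}_q}\ker(u-1)$. *)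

(* Defs.v *)
From HB Require Import structures.
From mathcomp Require Import all_boot all_order all_algebra all_field.
Set Implicit Arguments. Unset Strict Implicit. Unset Printing Implicit Defensive.
Import Order.TTheory GRing.Theory Num.Theory.
Local Open Scope ring_scope.

Definition fixdim (F : fieldType) (n : nat) (u : 'M[F]_n) : nat :=
  \rank (kermx (u - 1%:M)).

Definition regular_elliptic (F : fieldType) (n : nat) (c : 'M[F]_n) : Prop :=
  [/\ c \in unitmx,
      (forall U : 'M[F]_n, stablemx U c -> (U == 0) || row_full U)
    & (n = 1%N -> c <> 1%:M)].

Definition GLcard (F : finFieldType) (n : nat) : nat :=
  #|[set u : 'M[F]_n | u \in unitmx]|.

Definition pair_count (F : finFieldType) (n : nat) (c : 'M[F]_n) (r s : nat) : nat :=
  #|[set p : 'M[F]_n * 'M[F]_n |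
      [&& p.1 \in unitmx, p.2 \in unitmx, p.1 *m p.2 == c,
          fixdim p.1 == r & fixdim p.2 == s]]|.

Definition qpoch_inv (q : rat) (z : {poly {poly rat}}) (m : nat) : {poly {poly rat}} :=
  \prod_(i < m) (1 - z * ((q ^+ i)^-1)%:P%:P).

Definition qpoch (q : rat) (m : nat) : rat := \prod_(i < m) (1 - q ^+ i.+1).

Definition qfact (q : rat) (m : nat) : rat := \prod_(i < m) \sum_(j < i.+1) q ^+ j.

(* Main.v *)
Require Import Defs.
From HB Require Import structures.
From mathcomp Require Import all_boot all_order all_algebra all_field.
From mathcomp Require Import mxabelem ring zify.
Set Implicit Arguments. Unset Strict Implicit. Unset Printing Implicit Defensive.
Import Order.TTheory GRing.Theory Num.Theory.
Local Open Scope ring_scope.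

(** Since [(q^k; q^-1)_t / (q; q)_t] is a Gaussian binomial coefficient, the
coefficient of [(x; q^-1)_t (y; q^-1)_u / ((q; q)_t (q; q)_u)] is, up to the
factor [1 / |G|], the number of triples [(g, A, B)] with [g] in [G] and [A], [B]
frames of [t] and [u] independent vectors such that [A g = A] and [B g = B c].
This number is that of bases [E] for which the first [t] vectors of [E] and the
images under [c] of the next [u] ones are independent.  Moebius inversion over
the relations between these [t + u] vectors reduces it to the bases in which [c]
maps the first [w] vectors to the next [w] ones.

The last number is an instance of a more general one.  Prescribe the first [k]
rows, [k < n], of the matrix of [c] in an unknown basis: there is no solution if
these rows leave invariant a nonzero subspace of the span of the first [k]
coordinates, and there are [(q^n - 1) prod_{k < i < n} (q^n - q^i)] of them
otherwise.  This goes by descending induction on [k]: among the [q^n] choices of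
the next row, exactly [q^(k+1)] create an invariant subspace.  The theorem
follows from a q-Vandermonde type summation. *)

(** * Finite q-series *)

Definition fall (q z : rat) (w : nat) : rat := \prod_(i < w) (z - q ^+ i).

(* The Gaussian binomial coefficient of [d] and [w] when [z = q ^+ d]. *)
Definition qbin (q z : rat) (w : nat) : rat := fall q z w / fall q (q ^+ w) w.

(** The value mu(0, V), for V of dimension [w], of the Moebius function of the lattice of subspaces
    over a field with [q] elements. *)
Definition mobius_coef (q : rat) (w : nat) : rat := (-1) ^+ w * q ^+ 'C(w, 2).

Lemma prod_mulc (a : rat) (f : nat -> rat) w :
  \prod_(i < w) (a * f i) = a ^+ w * \prod_(i < w) f i.
Proof. by rewrite big_split /= prodr_const card_ord. Qed.

Section QSeries.

Variable q : rat.
Hypothesis q_gt1 : 1 < q.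

Let q_neq0 : q != 0. Proof. by rewrite gt_eqF // (lt_trans ltr01). Qed.

Let expq_neq0 i : q ^+ i != 0. Proof. by rewrite expf_neq0. Qed.

Let expqS_neq1 i : q ^+ i.+1 - 1 != 0.
Proof. by rewrite subr_eq0 gt_eqF // exprn_egt1. Qed.

Lemma fall0 z : fall q z 0 = 1.
Proof. exact: big_ord0. Qed.

Lemma fallS z w : fall q z w.+1 = fall q z w * (z - q ^+ w).
Proof. exact: big_ord_recr. Qed.

Lemma fall_mulq z w : fall q (q * z) w.+1 = (q * z - 1) * q ^+ w * fall q z w.
Proof.
rewrite /fall big_ord_recl expr0 -mulrA; congr (_ * _).
rewrite -(prod_mulc q (fun i => z - q ^+ i)).
by apply: eq_bigr => i _; rewrite lift0 exprS mulrBr.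
Qed.

Lemma fall_small d w : (d < w)%N -> fall q (q ^+ d) w = 0.
Proof.
by move=> dw; rewrite /fall (bigD1 (Ordinal dw)) //= subrr mul0r.
Qed.

Lemma fall_expq_neq0 d w : (w <= d)%N -> fall q (q ^+ d) w != 0.
Proof.
move=> wd; apply/prodf_neq0 => i _; rewrite subr_eq0 gt_eqF //.
by rewrite ltr_eXn2l // (leq_trans _ wd).
Qed.

Lemma qbin0 z : qbin q z 0 = 1.
Proof. by rewrite /qbin !fall0 divr1. Qed.

Lemma qbin_small d w : (d < w)%N -> qbin q (q ^+ d) w = 0.
Proof. by move=> dw; rewrite /qbin fall_small // mul0r. Qed.

(** Pascal's rule; writing [z] for [q ^+ d] turns the power of exponent [d - w] into the quotient
    [z / q ^+ w]. *)
Lemma qbin_pascal z w :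
  qbin q (q * z) w.+1 = qbin q z w.+1 + z / q ^+ w * qbin q z w.
Proof.
rewrite /qbin exprS !fall_mulq fallS -exprS.
have := fall_expq_neq0 (leqnn w); have := expqS_neq1 w; have := expq_neq0 w.
rewrite exprS; move: (q ^+ w) (fall q (q ^+ w) w) (fall q z w) => a b c.
by move=> a0 b0 c0; field; rewrite a0 b0 c0.
Qed.

Lemma mobius_coefS w : mobius_coef q w.+1 = - q ^+ w * mobius_coef q w.
Proof. by rewrite /mobius_coef binS bin1 exprD exprS; ring. Qed.

(** By Pascal's rule the sum for [d.+1] is [1 - q ^+ d] times the sum for [d], and one of these two
    factors is zero. Terms beyond [d] vanish, so a single bound [N] can serve all dimensions [d]. *)
Lemma qbin_mobius d N : (d <= N)%N ->
  \sum_(w < N.+1) mobius_coef q w * qbin q (q ^+ d) w = (d == 0%N)%:R.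
Proof.
elim: d N => [|d IH] N dN.
  rewrite big_ord_recl qbin0 big1 => [|i _]; last by rewrite qbin_small ?mulr0.
  by rewrite /mobius_coef bin0n !expr0 !mulr1 addr0.
case: N dN => // N dN.
have E i : mobius_coef q i.+1 * qbin q (q ^+ d.+1) i.+1
    = mobius_coef q i.+1 * qbin q (q ^+ d) i.+1
      + (- q ^+ d) * (mobius_coef q i * qbin q (q ^+ d) i).
  rewrite exprS qbin_pascal mulrDr mobius_coefS; congr (_ + _).
  by have := expq_neq0 i => i0; field.
rewrite big_ord_recl qbin0; under eq_bigr => i _ do rewrite lift0 E.
rewrite big_split addrA /= -mulr_sumr IH //.
have -> : mobius_coef q 0 * 1
    + \sum_(i < N.+1) mobius_coef q i.+1 * qbin q (q ^+ d) i.+1 = (d == 0%N)%:R.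
  by rewrite -(IH N.+1 (ltnW dN)) [RHS]big_ord_recl qbin0.
by case: (d) => [|k]; rewrite ?expr0 /= ?mulr0 ?addr0 ?mulr1 ?subrr.
Qed.

(** At [z = q ^+ t] and [x = q ^+ n] this is, up to a product, the mean number over G of the pairs
    of frames. Both variables stay free because the recurrence in [u] rescales them. *)
Definition qvander (u : nat) (z x : rat) : rat :=
  \sum_(w < u.+1) mobius_coef q w * qbin q (q ^+ u) w * fall q z w
    * \prod_(w <= i < u) (x - q ^+ i.+1).

(** Pascal's rule splits each term in two. The first parts form the sum for [u] with one more
    factor; in the second parts, after a shift of [w], [z - 1] and a power of [q] come out, leaving
    [z / q] and [x / q]. *)
Lemma qvander_rec u z x : qvander u.+1 z x =
  (x - q ^+ u.+1) * qvander u z x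
  - (z - 1) * q ^+ (u + u) * qvander u (z / q) (x / q).
Proof.
pose P w := \prod_(w <= i < u.+1) (x - q ^+ i.+1).
have E i : mobius_coef q i.+1 * qbin q (q ^+ u.+1) i.+1 * fall q z i.+1 * P i.+1
    = mobius_coef q i.+1 * qbin q (q ^+ u) i.+1 * fall q z i.+1 * P i.+1
    + mobius_coef q i.+1 * (q ^+ u / q ^+ i * qbin q (q ^+ u) i) * fall q z i.+1
      * P i.+1.
  by rewrite exprS qbin_pascal mulrDr !mulrDl.
rewrite {1}/qvander big_ord_recl qbin0.
rewrite (eq_bigr _ (fun (i : 'I_u.+1) _ => E i)) big_split /= addrA {E}/P.
congr (_ + _).
  transitivity (\sum_(w < u.+2) mobius_coef q w * qbin q (q ^+ u) w
     * fall q z w * \prod_(w <= i < u.+1) (x - q ^+ i.+1)).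
    by rewrite [RHS]big_ord_recl qbin0.
  rewrite big_ord_recr /= qbin_small // mulr0 !mul0r addr0 /qvander mulr_sumr.
  apply: eq_bigr => i _; rewrite big_nat_recr /=; first by ring.
  by rewrite -ltnS.
rewrite /qvander mulr_sumr -sumrN; apply: eq_bigr => i _.
have iu : (i <= u)%N by rewrite -ltnS.
rewrite mobius_coefS.
have -> : fall q z i.+1 = (z - 1) * q ^+ i * fall q (z / q) i.
  by have := fall_mulq (z / q) i; rewrite (mulrC q) divfK.
have -> : \prod_(i.+1 <= j < u.+1) (x - q ^+ j.+1)
     = q ^+ (u - i) * \prod_(i <= j < u) (x / q - q ^+ j.+1).
  rewrite big_add1 /= -prodr_const_nat -big_split /=.
  by apply: eq_bigr => j _; rewrite (exprS q j.+1); field.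
have i0 := expq_neq0 i; rewrite exprD.
have -> : q ^+ u = q ^+ (u - i) * q ^+ i by rewrite -exprD subnK.
by field.
Qed.

(** The product is homogeneous in [x] and [z], so by induction both terms of [qvander_rec] contain
    it up to a power of [q]. The last factor becomes [q^n - q^t - q^u + 1] in the theorem. *)
Lemma qvander_closed u z x : qvander u.+1 z x =
  (\prod_(i < u) (x - z * q ^+ i.+1)) * (x - z - q ^+ u.+1 + 1).
Proof.
elim: u z x => [|u IH] z x.
  rewrite qvander_rec /qvander !big_ord_recl !big_ord0 !qbin0 !fall0.
  by rewrite !big_geq // /mobius_coef bin0n !expr0 expr1; ring.
rewrite qvander_rec !IH big_ord_recr /=.
have -> : \prod_(i < u) (x / q - z / q * q ^+ i.+1)
    = (\prod_(i < u) (x - z * q ^+ i.+1)) / q ^+ u.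
  rewrite -exprVn [RHS]mulrC -(prod_mulc _ (fun i => x - z * q ^+ i.+1)).
  by apply: eq_bigr => i _ /=; ring.
have := expq_neq0 u; rewrite !(exprS, exprD).
move: (\prod_(i < u) _) (q ^+ u) => a b b0.
by field; rewrite q_neq0 b0.
Qed.

Lemma qfactS m : qfact q m.+1 * (q - 1) = qfact q m * (q ^+ m.+1 - 1).
Proof.
rewrite /qfact big_ord_recr /= -mulrA; congr (_ * _).
by rewrite mulrC -subrX1.
Qed.

Lemma qfact_neq0 m : qfact q m != 0.
Proof.
elim: m => [|m IH]; first by rewrite /qfact big_ord0 oner_eq0.
have: qfact q m.+1 * (q - 1) != 0 by rewrite qfactS mulf_neq0.
by apply: contra => /eqP ->; rewrite mul0r.
Qed.

Lemma fall_qfact m k : fall q (q ^+ (m + k)) k * qfact q m =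
  q ^+ 'C(k, 2) * (q - 1) ^+ k * qfact q (m + k).
Proof.
elim: k => [|k IH]; first by rewrite fall0 addn0 bin0n !expr0 !mul1r.
rewrite addnS [in fall _ _ _]exprS fall_mulq -mulrA IH binS bin1 !exprD.
transitivity (q ^+ k * q ^+ 'C(k, 2) * (q - 1) ^+ k
              * (qfact q (m + k).+1 * (q - 1))).
  by rewrite qfactS exprS !exprD; ring.
by rewrite [(q - 1) ^+ k.+1]exprS; ring.
Qed.

Lemma qpoch_neq0 m : qpoch q m != 0.
Proof.
by apply/prodf_neq0 => i _; rewrite -opprB oppr_eq0.
Qed.

Lemma qvander_coef n t u : (t < n)%N -> (u < n)%N -> (t + u <= n)%N ->
  qvander u (q ^+ t) (q ^+ n) / \prod_(i < u) (q ^+ n - q ^+ i.+1)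
  = q ^ ((t * u)%:Z - t%:Z - u%:Z)
     * (qfact q (n - t - 1) * qfact q (n - u - 1))
       / (qfact q (n - 1) * qfact q (n - t - u))
     * ((q ^+ n - q ^+ t - q ^+ u + 1) / (q - 1)).
Proof.
move=> tn un tun.
have q10 : q - 1 != 0 by have := expqS_neq1 0; rewrite expr1.
(* [qvander_closed] starts at [u = 1]; for [u = 0] the left side is 1. *)
case: u un tun => [|v] un tun.
  have -> : q ^ ((t * 0)%:Z - t%:Z - 0%:Z) = (q ^+ t)^-1.
    by rewrite exprnN; congr (_ ^ _); lia.
  rewrite !subn0 big_ord0 divr1 /qvander big_ord_recl big_ord0 qbin0.
  rewrite fall0 big_geq // /mobius_coef bin0n !expr0.
  have [m ->] : exists m, n = (t + m.+1)%N by exists (n - t).-1; lia.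
  rewrite addKn subSS subn0.
  have e := qfactS m; have := qfact_neq0 m; have := qfact_neq0 m.+1.
  have := qfact_neq0 (t + m.+1 - 1); have := expq_neq0 t.
  have -> : qfact q m = qfact q m.+1 * (q - 1) / (q ^+ m.+1 - 1).
    by rewrite e mulfK.
  rewrite exprD; have := expqS_neq1 m.
  move: (q ^+ m.+1) (q ^+ t) (qfact q _) (qfact q _) => a b c d a0 b0 c0 d0 _.
  by field; rewrite b0 a0 q10 d0 c0.
have [m En] : exists m, n = (t + v.+1 + m)%N by exists (n - (t + v.+1))%N; lia.
have -> : (n - t - 1 = m + v)%N by lia.
have -> : (n - t - v.+1 = m)%N by lia.
set k := (n - v.+1 - 1)%N.
have -> : (n - 1 = k + v.+1)%N by rewrite /k; lia.
have -> : q ^ ((t * v.+1)%:Z - t%:Z - v.+1%:Z) = q ^+ (t * v) / q ^+ v.+1.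
  by rewrite exprnN exprnP -expfzDr //; congr (_ ^ _); lia.
rewrite qvander_closed.
(* Each factor contains [q ^+ (t + 1)], because [n = t + 1 + (m + v)]. *)
have -> : \prod_(i < v) (q ^+ n - q ^+ t * q ^+ i.+1)
   = q ^+ (t * v) * q ^+ v * fall q (q ^+ (m + v)) v.
  rewrite exprM -exprMn -(prod_mulc _ (fun i => q ^+ (m + v) - q ^+ i)).
  apply: eq_bigr => i _ /=; rewrite En.
  have -> : (t + v.+1 + m = t + 1 + (m + v))%N by lia.
  by rewrite !exprD expr1 exprS; ring.
have -> : \prod_(i < v.+1) (q ^+ n - q ^+ i.+1)
   = q ^+ v.+1 * fall q (q ^+ (k + v.+1)) v.+1.
  rewrite -(prod_mulc _ (fun i => q ^+ (k + v.+1) - q ^+ i)).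
  apply: eq_bigr => i _ /=.
  have -> : (n = (k + v.+1).+1)%N by rewrite /k; lia.
  by rewrite !exprS; ring.
have e1 := fall_qfact m v; have e2 := fall_qfact k v.+1.
have m0 := qfact_neq0 m; have k0 := qfact_neq0 k.
have -> : fall q (q ^+ (m + v)) v
   = q ^+ 'C(v, 2) * (q - 1) ^+ v * qfact q (m + v) / qfact q m.
  by rewrite -e1 mulfK.
have -> : fall q (q ^+ (k + v.+1)) v.+1
   = q ^+ 'C(v.+1, 2) * (q - 1) ^+ v.+1 * qfact q (k + v.+1) / qfact q k.
  by rewrite -e2 mulfK.
have kv0 := qfact_neq0 (k + v.+1).
rewrite binS bin1 !exprS !exprD.
have p0 : (q - 1) ^+ v != 0 by rewrite expf_neq0.
have v0 := expq_neq0 v; have c0 := expq_neq0 'C(v, 2).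
have t0 := expq_neq0 (t * v).
field.
by rewrite kv0 q10 m0 q_neq0 c0 v0 k0 p0.
Qed.

(** A form of the q-binomial theorem, by induction on [r]: multiplying [qpoch_inv q x t] by [x]
    gives [q ^+ t] times its difference with the next one. The coefficients contain numbers of
    frames, which is how these enter the count. *)
Lemma expr_qpoch_inv (x : {poly {poly rat}}) r N : (r <= N)%N ->
  x ^+ r = \sum_(t < N.+1)
    (fall q (q ^+ r) t / qpoch q t)%:P%:P * qpoch_inv q x t.
Proof.
move=> rN.
have P0 : qpoch_inv q x 0 = 1 by rewrite /qpoch_inv big_ord0.
have xP t : x * qpoch_inv q x t
    = (q ^+ t)%:P%:P * (qpoch_inv q x t - qpoch_inv q x t.+1).
  rewrite {3}/qpoch_inv big_ord_recr /= -/(qpoch_inv q x t).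
  transitivity (((q ^+ t)%:P%:P * (q ^- t)%:P%:P) * (x * qpoch_inv q x t)).
    by rewrite -!rmorphM /= divff // !rmorph1 mul1r.
  by ring.
elim: r N rN => [|r IH] N rN.
  rewrite expr0 big_ord_recl fall0 P0 /qpoch big_ord0 divr1 mulr1 rmorph1.
  rewrite big1 ?addr0 //.
  by move=> i _; rewrite fall_small // mul0r !rmorph0 mul0r.
rewrite exprS (IH N (ltnW rN)) mulr_sumr.
under eq_bigr => t _ do rewrite mulrCA xP mulrA -!rmorphM mulrBr.
rewrite sumrB [X in X - _]big_ord_recl [X in _ - X]big_ord_recr /=.
rewrite (fall_small rN) !mul0r.
rewrite addr0 [RHS]big_ord_recl -addrA -sumrB.
congr (_ + _); first by rewrite !fall0 expr0 mulr1.
apply: eq_bigr => t _; rewrite lift0 /bump /= add1n -mulrBl -!polyCB.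
congr (_%:P%:P * _).
have e0 := qpoch_neq0 t; have := expqS_neq1 t; rewrite -opprB oppr_eq0 => e1.
have -> : qpoch q t.+1 = qpoch q t * (1 - q ^+ t.+1).
  by rewrite /qpoch big_ord_recr.
rewrite [q ^+ r.+1]exprS fall_mulq fallS.
move: e1; rewrite exprS => e1.
by field; rewrite e0 e1.
Qed.

End QSeries.

(** * Creation of stable subspaces *)

Section RowFree.

Variable F : finFieldType.
Let q : rat := #|F|%:R.

Lemma row_free_col_mx (t n : nat) (v : 'rV[F]_n) (a : 'M[F]_(t, n)) :
  row_free (col_mx v a) = row_free a && ~~ (v <= a)%MS.
Proof.
apply/idP/andP => [fva | [fa va]].
  split.
    apply: inj_row_free => y ya0.
    have : row_mx 0 y *m col_mx v a = 0 by rewrite mul_row_col mul0mx add0r.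
    by move/eqP; rewrite mulmx_free_eq0 // row_mx_eq0 => /andP[_ /eqP].
  apply/negP => /submxP[y vE].
  have : row_mx 1%:M (- y) *m col_mx v a = 0.
    by rewrite mul_row_col mul1mx mulNmx -vE subrr.
  move/eqP; rewrite mulmx_free_eq0 // row_mx_eq0 => /andP[/eqP].
  by move/matrixP => /(_ 0 0) /eqP; rewrite !mxE eqxx oner_eq0.
apply: inj_row_free => y; rewrite -[y]hsubmxK mul_row_col.
set al := lsubmx _; set be := rsubmx _ => E.
have al0 : al = 0.
  apply/eqP; apply: contraR va => al0.
  have al00 : al 0 0 != 0.
    by apply: contra al0 => /eqP h; rewrite [al]mx11_scalar h raddf0.
  have -> : v = (- (al 0 0)^-1 *: be) *m a.
    move/eqP: E; rewrite [X in X *m v + _]mx11_scalar addrC addr_eq0 mul_scalar_mx.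
    move/eqP => E; rewrite -scalemxAl E scaleNr scalerN opprK scalerA.
    by rewrite mulVf // scale1r.
  exact: submxMl.
move: E; rewrite al0 mul0mx add0r => /eqP; rewrite mulmx_free_eq0 // => /eqP ->.
by rewrite row_mx0.
Qed.

(** A frame of [t.+1] vectors is a frame of [t] vectors together with a vector of [W] outside its
    span. *)
Lemma card_row_free_sub (t n m : nat) (W : 'M[F]_(m, n)) :
  #|[set a : 'M[F]_(t, n) | row_free a && (a <= W)%MS]|%:R
  = fall q (q ^+ \rank W) t.
Proof.
elim: t => [|t IH].
  rewrite fall0 [X in #|pred_of_set X|](_ : _ = [set 0]) ?cards1 //.
  apply/setP => a; rewrite !inE flatmx0 sub0mx eqxx andbT.
  by apply: inj_row_free => y _; rewrite [y]thinmx0.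
rewrite fallS -IH -!sum1_card.
rewrite (reindex (fun p : 'rV[F]_n * 'M[F]_(t, n) => col_mx p.1 p.2)) /=; last first.
  exists (fun a : 'M[F]_(1 + t, n) => (usubmx a, dsubmx a)) => [[v a]|a] _ /=.
    by rewrite col_mxKu col_mxKd.
  exact: vsubmxK.
rewrite (eq_bigl (fun p : 'rV[F]_n * 'M[F]_(t, n) =>
   (p.2 \in [set a : 'M[F]_(t, n) | row_free a && (a <= W)%MS])
   && (p.1 \in rowg W :\: rowg p.2))); last first.
  move=> [v a]; rewrite !inE row_free_col_mx.
  rewrite (_ : (col_mx v a <= W)%MS = (v <= W)%MS && (a <= W)%MS);
    last exact: col_mx_sub.
  by case: (row_free a); case: (v <= W)%MS; case: (a <= W)%MS; rewrite ?andbF ?andbT.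
rewrite -(pair_big_dep xpredT (fun v a => (a \in _) && (v \in rowg W :\: rowg a))
           (fun _ _ => 1%N)) /=.
rewrite (exchange_big_dep (mem [set a : 'M[F]_(t, n) | row_free a && (a <= W)%MS]))
  /=; last by move=> v a _ /andP[].
rewrite natr_sum [in RHS]natr_sum mulr_suml; apply: eq_bigr => a aP.
rewrite mul1r (eq_bigl (mem (rowg W :\: rowg a))); last first.
  by move=> v; rewrite /= aP.
move: aP; rewrite inE => /andP[/eqP fa aW].
rewrite sum1_card cardsDS; last first.
  by apply/subsetP => v; rewrite !mem_rowg => /submx_trans ->.
(* The frame [a] itself bounds [t], so the difference of cardinals is not truncated. *)
have tW : (t <= \rank W)%N by have := mxrankS aW; rewrite fa.
by rewrite !card_rowg fa natrB ?natrX // leq_pexp2l // ltnW // finNzRing_gt1.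
Qed.

Lemma GLcardE n : (GLcard F n)%:R = fall q (q ^+ n) n :> rat.
Proof.
rewrite -[in q ^+ n](@mxrank1 F n) -card_row_free_sub /GLcard.
by congr (_%:R); apply: eq_card => u; rewrite !inE row_free_unit submx1 andbT.
Qed.

End RowFree.

Section Extension.

Variables (F : finFieldType) (n : nat).
Implicit Types (C S T U W : 'M[F]_n) (phi : 'cV[F]_n).

(** Square matrices represent all subspaces, so the quantifier ranges over a finite type. *)
Definition nostable C T : bool :=
  [forall S : 'M[F]_n, (S <= T)%MS && stablemx S C ==> (S == 0)].

Lemma nostableP C T :
  reflect (forall S, (S <= T)%MS -> stablemx S C -> S = 0) (nostable C T).
Proof.
apply: (iffP forallP) => [h S ST SC | h S].
  by apply/eqP; move: (h S); rewrite ST SC.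
by apply/implyP => /andP[ST SC]; apply/eqP/h.
Qed.

Lemma nostablePn C T :
  reflect (exists S, [/\ (S <= T)%MS, stablemx S C & S != 0]) (~~ nostable C T).
Proof.
rewrite negb_forall; apply: (iffP existsP) => [] [S].
  by rewrite negb_imply => /andP[/andP[]]; exists S.
by case=> ST SC S0; exists S; rewrite negb_imply ST SC.
Qed.

Lemma eq_nostable C C' T : T *m C = T *m C' -> nostable C T = nostable C' T.
Proof.
move=> E; apply: eq_forallb => S; case: (boolP (S <= T)%MS) => //= /submxP[y ->].
by rewrite -!mulmxA E.
Qed.

Lemma nostableS C T T' : (T' <= T)%MS -> nostable C T -> nostable C T'.
Proof.
move=> TT /nostableP h; apply/nostableP => S ST; apply: h.
exact: submx_trans TT.
Qed.

Lemma exists_phi_eq1 S phi : S *m phi != 0 ->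
  exists2 z : 'rV_n, (z <= S)%MS & z *m phi = 1%:M.
Proof.
case/rowV0Pn => v /submxP[y vE] v0.
have v00 : v 0 0 != 0.
  by apply: contra v0 => /eqP h; rewrite [v]mx11_scalar h raddf0.
exists ((v 0 0)^-1 *: (y *m S)); first by rewrite scalemx_sub ?submxMl.
rewrite -scalemxAl -mulmxA -vE [X in _ *: X]mx11_scalar scale_scalar_mx.
by rewrite mulVf.
Qed.

Lemma rank_cap_ker T phi : T *m phi != 0 ->
  \rank T = (\rank (T :&: kermx phi)%MS).+1.
Proof.
move=> Tphi; rewrite -(mxrank_mul_ker T phi).
suff -> : \rank (T *m phi) = 1%N by [].
apply/eqP; rewrite eqn_leq rank_leq_col /=.
by rewrite lt0n mxrank_eq0.
Qed.

Lemma card_translate (T : 'M[F]_n) (y : 'rV[F]_n) :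
  #|[set x : 'rV_n | ((y + x)%R <= T)%MS]| = (#|F| ^ \rank T)%N.
Proof.
rewrite -card_rowg -(card_preimset (rowg T) (addrI y)).
by apply: eq_card => x; rewrite !inE.
Qed.

(* With [U = T :&: kermx phi], every new stable subspace meets [e + U] in a
   vector [e + s] that is mapped into [T], and [s] is determined modulo the
   preimage [U1] of [T] in [U]; so the count for [T] inside [W] reduces to the
   count for [U1 + <e + s>] inside [T]. *)
Lemma card_stable_extension C T W phi :
  (T <= W)%MS -> (T *m C <= W)%MS -> T *m phi != 0 ->
  nostable C (T :&: kermx phi)%MS ->
  #|[set x : 'rV_n | (x <= W)%MS && ~~ nostable (C + phi *m x) T]|
  = (#|F| ^ \rank T)%N.
Proof.
have [r] := ubnP (\rank T); elim: r C T W => // r IH C T W rT TW TCW Tphi nsU.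
set Inv := [set x | _].
have [e eT ephi] := exists_phi_eq1 Tphi.
set U := (T :&: kermx phi)%MS in nsU.
set U1 := (U :&: kermx (C *m cokermx T))%MS.
have U1U : (U1 <= U)%MS by exact: capmxSl.
have UT : (U <= T)%MS by exact: capmxSl.
have Uphi m (s : 'M_(m, n)) : (s <= U)%MS -> s *m phi = 0.
  by rewrite sub_capmx => /andP[_ /sub_kermxP].
have inU m (s : 'M_(m, n)) : (s <= T)%MS -> s *m phi = 0 -> (s <= U)%MS.
  by move=> sT sphi; rewrite sub_capmx sT; apply/sub_kermxP.
have U1P m (s : 'M_(m, n)) : (s <= U1)%MS = (s <= U)%MS && (s *m C <= T)%MS.
  rewrite sub_capmx; congr (_ && _); rewrite [RHS]submxE -mulmxA.
  by apply/sub_kermxP/eqP.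
have CxE x m (s : 'M_(m, n)) : s *m phi = 0 -> s *m (C + phi *m x) = s *m C.
  by move=> s0; rewrite mulmxDr mulmxA s0 mul0mx addr0.
have CzE x (z : 'rV_n) : z *m phi = 1%:M -> z *m (C + phi *m x) = z *m C + x.
  by move=> z1; rewrite mulmxDr mulmxA z1 mul1mx.
have esphi (s : 'rV_n) : (s <= U)%MS -> (e + s) *m phi = 1%:M.
  by move=> sU; rewrite mulmxDl ephi (Uphi _ _ sU) addr0.
have esT (s : 'rV_n) : (s <= U)%MS -> ((e + s)%R <= T)%MS.
  by move=> sU; rewrite addmx_sub // (submx_trans sU).
(* On [U] the new map agrees with [C], so a new stable subspace cannot lie in the kernel of
   [phi]. *)
have InvP x : x \in Inv -> exists S, exists2 z : 'rV_n,
    [/\ (S <= T)%MS, stablemx S (C + phi *m x) & S != 0]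
    & (z <= S)%MS /\ z *m phi = 1%:M.
  rewrite inE => /andP[xW /nostablePn[S [ST SC S0]]].
  have [|z zS zphi] := @exists_phi_eq1 S phi; last by exists S; exists z.
  apply: contra S0 => /eqP Sphi; apply/eqP.
  apply: (nostableP _ _ nsU); first exact: inU.
  by rewrite -(CxE x).
(* The vector [z] of a stable subspace is one solution [e + s], and solutions differ by elements of
   [U1]: the set of [s] is a coset of [U1]. *)
have count_s x : x \in Inv ->
    #|[set s : 'rV_n | (s <= U)%MS && (((e + s) *m (C + phi *m x))%R <= T)%MS]|
    = (#|F| ^ \rank U1)%N.
  move=> /InvP[S [z [ST SC S0] [zS zphi]]].
  rewrite -(card_translate U1 (e - z)); apply: eq_card => s; rewrite !inE U1P.
  have zC : ((z *m (C + phi *m x))%R <= T)%MS.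
    by rewrite (submx_trans _ ST) // (submx_trans _ SC) // submxMr.
  have ezU : ((e - z)%R <= U)%MS.
    apply: inU; last by rewrite mulmxBl ephi zphi subrr.
    by rewrite addmx_sub // eqmx_opp (submx_trans zS).
  have -> : (s <= U)%MS = ((e - z + s)%R <= U)%MS.
    apply/idP/idP => [sU | h]; first by rewrite addmx_sub.
    by rewrite -[s](addKr (e - z)) addmx_sub // eqmx_opp.
  case: (boolP ((e - z + s)%R <= U)%MS) => //= hU.
  rewrite -(CxE x); last exact: Uphi.
  have -> : e - z + s = e + s - z by rewrite addrAC.
  rewrite mulmxBl; apply/idP/idP => h.
    by rewrite addmx_sub // eqmx_opp.
  by rewrite -[X in (X <= _)%MS](subrK (z *m (C + phi *m x))) addmx_sub.
have count_x (s : 'rV_n) : (s <= U)%MS ->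
    #|[set x in Inv | (((e + s) *m (C + phi *m x))%R <= T)%MS]|
    = (#|F| ^ (\rank U1).+1)%N.
  move=> sU; set z := e + s.
  have zphi : z *m phi = 1%:M by exact: esphi.
  have zT : (z <= T)%MS by exact: esT.
  have zCW : (z *m C <= W)%MS by rewrite (submx_trans _ TCW) // submxMr.
  have xW (x : 'rV_n) : ((z *m C + x)%R <= T)%MS -> (x <= W)%MS.
    move=> h; rewrite -[x](addKr (z *m C)) addmx_sub ?eqmx_opp //.
    exact: submx_trans TW.
  (* If [C] maps all of [U] into [T], then [T] itself becomes stable as soon as [z] is mapped into
     [T]. *)
  have [UU1 | UU1] := boolP (U <= U1)%MS.
    have rTU1 : \rank T = (\rank U1).+1.
      by rewrite (rank_cap_ker Tphi); congr _.+1; apply/eqP; rewrite eqn_leq !mxrankS.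
    rewrite -rTU1 -(card_translate T (z *m C)); apply: eq_card => x.
    rewrite !inE (CzE _ _ zphi); apply/andP/idP => [[] // | h]; split=> //.
    rewrite (xW _ h); apply/nostablePn; exists T; split=> //; last first.
      by apply: contra Tphi => /eqP ->; rewrite mul0mx.
    apply/rV_subP => _ /submxP[y ->].
    rewrite mulmxA; set v := y *m T.
    have vT : (v <= T)%MS by exact: submxMl.
    have vzU : ((v - (v *m phi) *m z)%R <= U)%MS.
      apply: inU; last by rewrite mulmxBl -(mulmxA _ z) zphi mulmx1 subrr.
      by rewrite addmx_sub // eqmx_opp (submx_trans (submxMl _ _)).
    rewrite -[v](subrK ((v *m phi) *m z)) mulmxDl addmx_sub //.
      rewrite CxE; last exact: Uphi.
      by move: (submx_trans vzU UU1); rewrite U1P => /andP[].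
    by rewrite -(mulmxA _ z) (CzE _ _ zphi) (submx_trans (submxMl _ _)).
  (* Otherwise [T1] has smaller rank than [T], and it contains every new stable subspace once [z] is
     mapped into [T]. *)
  set T1 := (U1 + z)%MS.
  have T1T : (T1 <= T)%MS by rewrite addsmx_sub zT (submx_trans U1U).
  have U1T1 : (U1 <= T1)%MS by exact: addsmxSl.
  have zT1 : (z <= T1)%MS by exact: addsmxSr.
  have T1ker : (T1 :&: kermx phi :=: U1)%MS.
    apply/eqmxP/andP; split.
      apply/rV_subP => v; rewrite sub_capmx => /andP[/sub_addsmxP[[a b] /= vE]].
      move/sub_kermxP; rewrite vE mulmxDl -(mulmxA b) zphi mulmx1.
      rewrite (Uphi _ (a *m U1)); last by rewrite (submx_trans (submxMl _ _)).
      by rewrite add0r => ->; rewrite mul0mx addr0 submxMl.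
    by rewrite sub_capmx U1T1; apply/sub_kermxP/Uphi.
  have T1phi : T1 *m phi != 0.
    apply: contraTneq zT1 => h; apply/negP => /submxP[y zE].
    move: zphi; rewrite zE -mulmxA h mulmx0 => /matrixP/(_ 0 0)/eqP.
    by rewrite !mxE eq_sym oner_eq0.
  have rT1 : \rank T1 = (\rank U1).+1 by rewrite (rank_cap_ker T1phi) T1ker.
  (* [C1] agrees with [C] on [U1] and kills [z], hence maps [T1] into [T], as the induction
     hypothesis requires with [T] as ambient space. Translating [x] by [z *m C] compensates for the
     change. *)
  set C1 := C - phi *m (z *m C).
  have zC1 : z *m C1 = 0 by rewrite mulmxBr mulmxA zphi mul1mx subrr.
  have U1C1 : U1 *m C1 = U1 *m C.
    by rewrite mulmxBr [U1 *m (phi *m _)]mulmxA (Uphi _ U1) // mul0mx subr0.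
  rewrite -rT1 -(IH C1 T1 T) //; first last.
  - rewrite (eq_nostable (C' := C)).
      by apply: nostableS nsU; rewrite T1ker.
    have /submxP[y ->] : (T1 :&: kermx phi <= U1)%MS by rewrite T1ker.
    by rewrite -!mulmxA U1C1.
  - rewrite addsmxMr zC1 addsmx0 U1C1.
    by have := submx_refl U1; rewrite {2}/U1 -/U1 U1P => /andP[].
  - rewrite rT1 -ltnS (leq_trans _ rT) // ltnS (rank_cap_ker Tphi) ltnS.
    by rewrite ltn_neqAle mxrankS // andbT; apply: contra UU1 => /eqP h;
      rewrite -(mxrank_leqif_sup U1U) h.
  rewrite -[RHS](card_preimset _ (addrI (z *m C))).
  apply: eq_card => x; rewrite !inE (CzE _ _ zphi).
  have -> : C1 + phi *m (z *m C + x) = C + phi *m x.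
    by rewrite mulmxDr addrA subrK.
  rewrite andbC; case: (boolP ((z *m C + x)%R <= T)%MS) => //= h.
  rewrite (xW _ h) /=; apply/idP/idP; last first.
    by apply: contra; apply: nostableS.
  move=> inv; have /InvP[S [z' [ST SC S0] [zS zphi']]] : x \in Inv.
    by rewrite inE (xW _ h).
  apply/nostablePn; exists S; split=> //.
  have inU1 (v : 'rV_n) : (v <= T)%MS -> v *m phi = 0 ->
      ((v *m (C + phi *m x))%R <= T)%MS -> (v <= U1)%MS.
    by move=> vT vphi; rewrite U1P inU //= CxE.
  have SCT (v : 'rV_n) : (v <= S)%MS -> ((v *m (C + phi *m x))%R <= T)%MS.
    by move=> vS; rewrite (submx_trans _ ST) // (submx_trans _ SC) // submxMr.
  have z'T1 : (z' <= T1)%MS.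
    rewrite -[z'](subrK z) addmx_sub // (submx_trans _ U1T1) // inU1 //.
    - by rewrite addmx_sub ?eqmx_opp // (submx_trans zS).
    - by rewrite mulmxBl zphi zphi' subrr.
    - by rewrite mulmxBl addmx_sub ?SCT // eqmx_opp; move: h; rewrite -CzE.
  apply/rV_subP => v vS.
  have v'S : ((v - (v *m phi) *m z')%R <= S)%MS.
    by rewrite addmx_sub // eqmx_opp (submx_trans (submxMl _ _)).
  rewrite -[v](subrK ((v *m phi) *m z')) addmx_sub //; last first.
    by rewrite (submx_trans (submxMl _ _)).
  rewrite (submx_trans _ U1T1) // inU1 //.
  - exact: submx_trans ST.
  - by rewrite mulmxBl -(mulmxA _ z') zphi' mulmx1 subrr.
  - exact: SCT.
(* The pairs [(x, s)] such that [e + s] is mapped into [T] are counted in two ways. *)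
have double : (#|Inv| * #|F| ^ \rank U1
    = #|F| ^ \rank U * #|F| ^ (\rank U1).+1)%N.
  transitivity (\sum_(x in Inv) \sum_(s in rowg U |
      (((e + s) *m (C + phi *m x))%R <= T)%MS) 1)%N.
    rewrite -sum_nat_const; apply: eq_bigr => x xI.
    by rewrite -(count_s x xI) -sum1_card; apply: eq_bigl => s; rewrite !inE.
  rewrite (exchange_big_dep (mem (rowg U))) /=; last by move=> x s _ /andP[].
  rewrite -card_rowg -sum_nat_const; apply: eq_bigr => s sU.
  rewrite -(count_x s) -?sum1_card; last by rewrite -mem_rowg.
  by apply: eq_bigl => x; rewrite sU inE.
apply/eqP; rewrite (rank_cap_ker Tphi) -(@eqn_pmul2r (#|F| ^ \rank U1)); last first.
  by rewrite expn_gt0 (ltnW (finNzRing_gt1 F)).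
by rewrite double -/U !expnS mulnCA mulnA.
Qed.

End Extension.

(** * Bases with prescribed matrix rows *)

Section PidMx.

Variables (F : fieldType) (n : nat).

Lemma mul_pid_mxE (k p : nat) (A : 'M[F]_(n, p)) i j :
  ((pid_mx k : 'M_n) *m A) i j = A i j *+ (i < k)%N.
Proof.
rewrite mxE (bigD1 i) //= big1 => [|l li]; rewrite !mxE.
  by rewrite eqxx /= mulr_natl addr0.
by rewrite eq_sym val_eqE (negPf li) mul0r.
Qed.

Lemma eq_mul_pid_mx (k p : nat) (A B : 'M[F]_(n, p)) :
  (pid_mx k : 'M_n) *m A = pid_mx k *m B <->
  (forall i : 'I_n, (i < k)%N -> row i A = row i B).
Proof.
split=> [E i ik | E].
  apply/rowP => j; move/matrixP: E => /(_ i j).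
  by rewrite !mul_pid_mxE ik !mxE.
apply/matrixP => i j; rewrite !mul_pid_mxE.
by case: ltnP => // ik; move/rowP: (E i ik) => /(_ j); rewrite !mxE => ->.
Qed.

Lemma sub_pid_mxP (k m : nat) (S : 'M[F]_(m, n)) :
  reflect (forall i (j : 'I_n), (k <= j)%N -> S i j = 0)
          (S <= (pid_mx k : 'M_n))%MS.
Proof.
apply: (iffP idP) => [/submxP[y ->] i j kj | h].
  rewrite mxE big1 // => l _; rewrite !mxE; case: eqP => [-> | _] /=.
    by rewrite ltnNge kj mulr0.
  by rewrite mulr0.
suff -> : S = S *m pid_mx k by exact: submxMl.
apply/matrixP => i j; rewrite mxE (bigD1 j) //= big1 => [|l lj]; rewrite !mxE.
  by rewrite eqxx addr0 /=; case: ltnP => [|/h ->]; rewrite ?mulr1 ?mul0r.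
by rewrite val_eqE (negPf lj) mulr0.
Qed.

End PidMx.

Section Completions.

Variables (F : finFieldType) (n : nat) (c : 'M[F]_n).
Hypothesis n_gt0 : (0 < n)%N.
Hypothesis c_irr : forall U : 'M[F]_n, stablemx U c -> (U == 0) || row_full U.
Let q : rat := #|F|%:R.

(* The matrix of [c] in the basis formed by the rows of [E] is [E c E^-1]; only
   its first [k] rows are prescribed. *)
Definition completions (k : nat) (C : 'M[F]_n) : {set 'M[F]_n} :=
  [set E | (E \in unitmx)
           && ((pid_mx k : 'M_n) *m (E *m c) == pid_mx k *m (C *m E))].

(** [E] carries a [C]-stable subspace of the first [k] coordinates to a [c]-stable one of the same
    dimension, less than [n]; by irreducibility it is zero. *)
Lemma completions_nostable k C E : (k < n)%N -> E \in completions k C ->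
  nostable C (pid_mx k).
Proof.
rewrite inE => kn /andP[Eu /eqP EC]; apply/nostableP => S Sk SC.
have SEc : S *m E *m c = S *m C *m E.
  by case/submxP: Sk => y ->; rewrite -!mulmxA EC.
have /c_irr/orP[SE0 | SEfull] : stablemx (S *m E) c by rewrite SEc submxMr.
  by move: SE0; rewrite mulmx_free_eq0 ?row_free_unit // => /eqP.
move: SEfull; rewrite /row_full mxrankMfree ?row_free_unit // => /eqP rS.
by have := mxrankS Sk; rewrite rS rank_pid_mx ?(ltnW kn) // leqNgt kn.
Qed.

Lemma unitmx_neq0 (E : 'M[F]_n) : E \in unitmx -> E != 0.
Proof.
rewrite -row_free_unit /row_free; apply: contraTneq => ->.
by rewrite mxrank0 eq_sym -lt0n.
Qed.

(** If the last row of [E] depends on the others, the row space of [E] is [c]-stable, hence full.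
    Otherwise no relation between the rows involves the last one, so the left kernel of [E] is a
    [C]-stable subspace of the first [n.-1] coordinates, hence zero. *)
Lemma intertwiner_unit (C E : 'M[F]_n) : nostable C (pid_mx n.-1) ->
  (pid_mx n.-1 : 'M_n) *m (E *m c) = pid_mx n.-1 *m (C *m E) -> E != 0 ->
  E \in unitmx.
Proof.
set J : 'M[F]_n := pid_mx n.-1 => nsC EC E0.
have [EJ | nEJ] := boolP (E <= J *m E)%MS.
  have /c_irr : stablemx E c.
    by rewrite (submx_trans (submxMr c EJ)) // -mulmxA EC mulmxA submxMl.
  by rewrite (negPf E0) row_full_unit.
have kerJ (y : 'rV_n) : y *m E = 0 -> y *m J = y.
  move=> yE; apply/eqP; rewrite eq_sym -subr_eq0; apply: contraR nEJ => yJ.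
  have J1 : y - y *m J = y *m copid_mx n.-1 by rewrite mulmxBr mulmx1.
  have copidE : (copid_mx n.-1 <= y - y *m J)%MS.
    rewrite -(geq_leqif (mxrank_leqif_sup _)); last by rewrite J1 submxMl.
    by rewrite rank_copid_mx ?leq_pred // -subn1 subKn // lt0n mxrank_eq0.
  rewrite -[X in (X <= _)%MS](subrK (J *m E)) addmx_sub //.
  have -> : E - J *m E = copid_mx n.-1 *m E by rewrite mulmxBl mul1mx.
  rewrite (submx_trans (submxMr E copidE)) // mulmxBl yE sub0r eqmx_opp.
  by rewrite -mulmxA submxMl.
rewrite -row_free_unit -kermx_eq0; apply/eqP/(nostableP _ _ nsC).
  apply/rV_subP => y /sub_kermxP /kerJ <-; exact: submxMl.
apply/sub_kermxP; suff kJ : kermx E = kermx E *m J.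
  by rewrite kJ -!mulmxA -EC !mulmxA -kJ mulmx_ker mul0mx.
apply/row_matrixP => i; rewrite [RHS]row_mul kerJ //.
by apply/sub_kermxP; rewrite row_sub.
Qed.

(** A linear system of [n.-1 * n] equations in [n * n] unknowns has at least [#|F| ^ n] solutions.
    There are no more: a nonzero solution is invertible, so its first row is nonzero and the first
    row determines the solution. *)
Lemma card_completions_pred C : nostable C (pid_mx n.-1) ->
  #|completions n.-1 C| = (#|F| ^ n).-1.
Proof.
move=> nsC.
pose L := [set E : 'M[F]_n | (pid_mx n.-1 : 'M_n) *m (E *m c)
     == pid_mx n.-1 *m (C *m E)].
have L0 : 0 \in L by rewrite inE mul0mx !mulmx0.
have -> : completions n.-1 C = L :\ 0.
  apply/setP => E; rewrite !inE.
  apply/andP/andP => [[Eu EC] | [E0 /eqP EC]]; split=> //.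
  - exact: unitmx_neq0.
  - exact: (intertwiner_unit nsC).
  - exact/eqP.
suff -> : (#|F| ^ n = #|L|)%N by rewrite (cardsD1 0 L) L0.
apply/eqP; rewrite eqn_leq; apply/andP; split.
  (* The height [n.-1] makes the number of equations visible in the type of [lin_mx f]. *)
  pose J' : 'M[F]_(n.-1, n) := pid_mx n.-1.
  pose f := ((mulmx J' \o mulmxr c) \- (mulmx (J' *m C)))
     : 'M[F]_n -> 'M[F]_(n.-1, n).
  have <- : #|[set (vec_mx v : 'M[F]_n) | v in rowg (kermx (lin_mx f))]| = #|L|.
    apply: eq_card => E; apply/imsetP/idP => [[v] | EL].
      rewrite mem_rowg => /sub_kermxP vf ->; rewrite inE.
      move: vf; rewrite -[X in X *m _]vec_mxK mul_vec_lin => /eqP.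
      rewrite mxvec_eq0 /= subr_eq0 /J' => /eqP h; apply/eqP.
      have -> : (pid_mx n.-1 : 'M[F]_n) = (pid_mx n.-1 : 'M_(n, n.-1)) *m J'.
        by rewrite mul_pid_mx !minnn.
      by rewrite -!mulmxA h -!mulmxA.
    exists (mxvec E); last by rewrite mxvecK.
    rewrite mem_rowg; apply/sub_kermxP; rewrite mul_vec_lin /=.
    suff -> : J' *m (E *m c) = J' *m C *m E by rewrite subrr linear0.
    have -> : J' = J' *m (pid_mx n.-1 : 'M_n).
      by rewrite mul_pid_mx minnn (minn_idPr (leq_pred n)).
    by move: EL; rewrite inE -!mulmxA => /eqP ->.
  rewrite card_imset ?card_rowg; last exact: can_inj (@vec_mxK _ _ _).
  rewrite leq_exp2l ?finNzRing_gt1 // mxrank_ker.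
  have := rank_leq_col (lin_mx f); nia.
pose i0 := Ordinal n_gt0.
rewrite -[n in (_ ^ n)%N]mul1n -card_mx.
rewrite -(@card_in_imset _ _ (fun E : 'M[F]_n => row i0 E)) ?max_card // => E E'.
rewrite !inE => /eqP EC /eqP EC' rE; apply/eqP; rewrite -subr_eq0.
apply/negPn/negP => EE'.
have /intertwiner_unit : (pid_mx n.-1 : 'M_n) *m ((E - E') *m c)
    = pid_mx n.-1 *m (C *m (E - E')).
  by rewrite mulmxBl !mulmxBr EC EC'.
move=> /(_ nsC EE'); rewrite -row_free_unit => fE.
have : row i0 (1%:M : 'M[F]_n) *m (E - E') == 0.
  by rewrite -row_mul mul1mx linearB /= rE subrr.
rewrite mulmx_free_eq0 // => /eqP/rowP/(_ i0)/eqP.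
by rewrite !mxE eqxx oner_eq0.
Qed.

Lemma row_update_mul (k i : 'I_n) (C E : 'M[F]_n) (x : 'rV[F]_n) :
  row i ((C + (delta_mx k 0 : 'cV_n) *m x) *m E)
  = row i (C *m E) + (x *m E) *+ (i == k).
Proof.
rewrite mulmxDl linearD /=; congr (_ + _).
rewrite -mulmxA row_mul.
have -> : row i (delta_mx k 0 : 'cV[F]_n) = (i == k)%:R%:M :> 'M[F]_1.
  by apply/matrixP => a b; rewrite !ord1 !mxE eqxx andbT mulr1n.
by rewrite mul_scalar_mx scaler_nat.
Qed.

(** The basis [E] determines the next row of the matrix of [c]; [x] is the correction to row [k] of
    [C]. *)
Lemma completionsS (k : 'I_n) C E (x : 'rV[F]_n) :
  E \in completions k C ->
  (E \in completions k.+1 (C + (delta_mx k 0 : 'cV_n) *m x))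
  = (x == row k (E *m c *m invmx E) - row k C).
Proof.
rewrite !inE => /andP[Eu /eqP/eq_mul_pid_mx EC]; rewrite Eu /=.
have -> : (x == row k (E *m c *m invmx E) - row k C)
    = (row k (E *m c) == row k (C *m E) + x *m E).
  rewrite eq_sym subr_eq addrC; apply/eqP/eqP => h.
    by rewrite [in RHS]row_mul -mulmxDl -h -row_mul mulmxKV.
  by rewrite row_mul h [in LHS]row_mul -mulmxDl mulmxK.
apply/eqP/eqP => [/eq_mul_pid_mx/(_ k (ltnSn k)) | h].
  by rewrite row_update_mul eqxx.
apply/eq_mul_pid_mx => i; rewrite ltnS leq_eqVlt => /orP[/eqP/val_inj -> | ik].
  by rewrite row_update_mul eqxx.
by rewrite row_update_mul EC // (_ : (i == k) = false) ?addr0 // -val_eqE ltn_eqF.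
Qed.

Lemma card_completionsS (k : 'I_n) C :
  #|completions k C|
  = (\sum_(x : 'rV[F]_n) #|completions k.+1 (C + (delta_mx k 0 : 'cV_n) *m x)%R|)%N.
Proof.
rewrite -sum1_card.
rewrite (partition_big (fun E => row k (E *m c *m invmx E) - row k C) xpredT) //=.
apply: eq_bigr => x _; rewrite -sum1_card; apply: eq_bigl => E.
apply/andP/idP => [[EC /eqP xE] | EC].
  by rewrite completionsS // -xE.
suff EC' : E \in completions k C by split=> //; rewrite eq_sym -completionsS.
move: EC; rewrite !inE => /andP[-> /eqP/eq_mul_pid_mx h]; apply/eqP/eq_mul_pid_mx.
move=> i ik; rewrite h; last exact: ltnW.
by rewrite row_update_mul -val_eqE (ltn_eqF ik) addr0.
Qed.

(** The induction starts at [card_completions_pred]. A next row that creates a stable subspace has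
    no completion, by [completions_nostable]; such rows are counted by [card_stable_extension], with
    [phi] the coordinate of index [k]. *)
Lemma card_completions k C : (k < n)%N -> nostable C (pid_mx k) ->
  #|completions k C|%:R
  = (q ^+ n - 1) * \prod_(k.+1 <= i < n) (q ^+ n - q ^+ i).
Proof.
move=> kn; have [d Ed] : exists d, (n.-1 = k + d)%N by exists (n.-1 - k)%N; lia.
elim: d k kn Ed C => [|d IH] k kn Ed C nsC.
  have kE : k = n.-1 by rewrite Ed addn0.
  rewrite kE in nsC *; rewrite card_completions_pred // prednK // big_geq // mulr1.
  by rewrite -subn1 natrB ?expn_gt0 ?natrX // (ltnW (finNzRing_gt1 F)).
have kSn : (k.+1 < n)%N by lia.
pose k' := Ordinal kn; rewrite (card_completionsS k').
pose phi : 'cV[F]_n := delta_mx k' 0.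
rewrite (bigID (fun x => nostable (C + phi *m x) (pid_mx k.+1))) /=.
rewrite [X in (_ + X)%N]big1 ?addn0; last first.
  move=> x; apply: contraNeq; rewrite -lt0n => /card_gt0P[E].
  exact: completions_nostable.
rewrite natr_sum.
rewrite (eq_bigr (fun _ => (q ^+ n - 1) * \prod_(k.+2 <= i < n) (q ^+ n - q ^+ i)));
  last by move=> x nsx; apply: IH => //; rewrite Ed; lia.
rewrite sumr_const [in RHS]big_ltn // [RHS]mulrCA -[LHS]mulr_natl.
have phiT : (pid_mx k.+1 : 'M[F]_n) *m phi != 0.
  apply/eqP => /matrixP /(_ k' 0) /eqP.
  by rewrite mul_pid_mxE !mxE !eqxx ltnSn oner_eq0.
have := @card_stable_extension F n C (pid_mx k.+1) 1%:M phi (submx1 _) (submx1 _) phiT.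
have nsC' : nostable C ((pid_mx k.+1 : 'M[F]_n) :&: kermx phi)%MS.
  apply: nostableS nsC; apply/rV_subP => v; rewrite sub_capmx.
  case/andP => /sub_pid_mxP vk /sub_kermxP vphi; apply/sub_pid_mxP => i j.
  rewrite leq_eqVlt => /orP[/eqP kj | ]; last exact: vk.
  have -> : j = k' by exact: val_inj.
  move/matrixP: vphi => /(_ i 0); rewrite mxE (bigD1 k') //= big1 => [|l lk].
    by rewrite !mxE !eqxx mulr1 addr0.
  by rewrite mxE (negPf lk) mulr0.
move=> /(_ nsC'); rewrite rank_pid_mx // => cardI.
congr (_ * _).
have := cardC [pred x | nostable (C + phi *m x) (pid_mx k.+1)].
rewrite card_mx mul1n => cardT.
rewrite -natrX -natrX -cardT -cardI natrD.
set a := #|_|; set b := #|_|; set d' := #|_|.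
have -> : b = d' by apply: eq_card => x; rewrite !inE submx1.
by rewrite addrK.
Qed.

(** Complete [col_mx D1 D2] to a basis [H]: the condition says that, in the basis [H *m E], [c] maps
    the first [w] vectors to the next [w]. *)
Lemma card_intertwining (w : nat) (D1 D2 : 'M[F]_(w, n)) :
  row_free (col_mx D1 D2) ->
  #|[set E : 'M[F]_n | (E \in unitmx) && (D2 *m E == D1 *m E *m c)]|%:R
  = (q ^+ n - 1) * \prod_(w.+1 <= i < n) (q ^+ n - q ^+ i).
Proof.
move=> fD; have wn : (w + w <= n)%N by rewrite -(eqP fD) rank_leq_col.
have w_lt_n : (w < n)%N by lia.
pose P : 'M[F]_(w + w, n) := pid_mx (w + w).
have PPT : P *m P^T = 1%:M.
  by rewrite tr_pid_mx mul_pid_mx minnn (minn_idPr wn) pid_mx_1.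
have fP : row_free P by apply/row_freeP; exists P^T.
pose D := col_mx D1 D2.
have [|H Hu] := @complete_unitmx F (w + w) n P (P^T *m D).
  by rewrite mulmxA PPT mul1mx (eqP fD) (eqP fP).
rewrite mulmxA PPT mul1mx => DH.
pose fw : 'I_(w + w) -> 'I_n := widen_ord wn.
have PfE : P = rowsub fw 1%:M.
  by apply/matrixP => i j; rewrite !mxE ltn_ord andbT.
pose f1 i := fw (lshift w i); pose f2 i := fw (rshift w i).
have [D1H D2H] : D1 = rowsub f1 H /\ D2 = rowsub f2 H.
  move: DH; rewrite PfE -rowsubE => DH.
  have := congr1 usubmx DH; have := congr1 dsubmx DH.
  rewrite col_mxKu col_mxKd => -> ->.
  by split; apply/matrixP => i j; rewrite !mxE.
(* This shift by [w] moves the first [w] coordinates out of their span, so no nonzero subspace of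
   that span is stable. *)
pose C : 'M[F]_n := \matrix_(i, j) (j == (w + i)%N :> nat)%:R.
have rowC i E : row (f1 i) (C *m E) = row (f2 i) E.
  apply/rowP => j; rewrite !mxE (bigD1 (f2 i)) //= big1 => [|l li]; rewrite !mxE.
    by rewrite eqxx mul1r addr0.
  by rewrite (_ : (l == w + f1 i :> nat)%N = false) ?mul0r //; apply/negbTE.
have nsC : nostable C (pid_mx w).
  apply/nostableP => S Sw SC; apply/matrixP => i j; rewrite mxE.
  have [wj | jw] := leqP w j; first by move/sub_pid_mxP: Sw => ->.
  have wjn : (w + j < n)%N by apply: leq_trans (wn); rewrite ltn_add2l.
  have /sub_pid_mxP/(_ i (Ordinal wjn) (leq_addr _ _)) := submx_trans SC Sw.
  rewrite mxE (bigD1 j) //= big1 => [|l lj]; rewrite !mxE /=.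
    by rewrite eqxx mulr1 addr0.
  by rewrite eqn_add2l eq_sym val_eqE (negPf lj) mulr0.
rewrite -(card_completions w_lt_n nsC); congr (_%:R).
rewrite -[RHS](card_preimset _ (can_inj (mulKmx Hu))).
apply: eq_card => E; rewrite !inE unitmx_mul Hu /=; congr (_ && _).
rewrite D1H D2H !mul_rowsub_mx -mulmxA.
apply/eqP/eqP => [h | /eq_mul_pid_mx h].
  apply/eq_mul_pid_mx => i iw.
  have -> : i = f1 (Ordinal iw) by apply: val_inj.
  rewrite rowC; move/row_matrixP: h => /(_ (Ordinal iw)).
  by rewrite !row_rowsub -?mulmxA => ->.
apply/row_matrixP => i; rewrite !row_rowsub -rowC -h ?mulmxA //.
exact: (ltn_ord i).
Qed.

End Completions.

(** * Counting factorizations *)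

Section RowFreeBlocks.

Variable F : fieldType.

Lemma row_free_mulmx_unit (k n : nat) (X : 'M[F]_(k, n)) (g : 'M[F]_n) :
  g \in unitmx -> row_free (X *m g) = row_free X.
Proof. by move=> gu; rewrite /row_free mxrankMfree ?row_free_unit. Qed.

Lemma row_free_transitive (k n : nat) (X Y : 'M[F]_(k, n)) :
  row_free X -> row_free Y -> exists2 h : 'M_n, h \in unitmx & X *m h = Y.
Proof.
move=> fX fY; have /row_freeP[X' XX'] := fX.
have [|h hu] := @complete_unitmx F k n X (X' *m Y).
  by rewrite mulmxA XX' mul1mx (eqP fX) (eqP fY).
by rewrite mulmxA XX' mul1mx => ->; exists h.
Qed.

Lemma row_free_usubmx (t u n : nat) (X : 'M[F]_(t + u, n)) :
  row_free X -> row_free (usubmx X).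
Proof.
move=> fX; apply: inj_row_free => y yX.
have : row_mx y 0 *m X == 0.
  by rewrite -[X]vsubmxK mul_row_col yX mul0mx addr0.
by rewrite mulmx_free_eq0 // row_mx_eq0 => /andP[/eqP].
Qed.

Lemma row_free_dsubmx (t u n : nat) (X : 'M[F]_(t + u, n)) :
  row_free X -> row_free (dsubmx X).
Proof.
move=> fX; apply: inj_row_free => y yX.
have : row_mx 0 y *m X == 0.
  by rewrite -[X]vsubmxK mul_row_col yX mul0mx addr0.
by rewrite mulmx_free_eq0 // row_mx_eq0 => /andP[_ /eqP].
Qed.

Lemma row_free_lsubmx (k t u : nat) (D : 'M[F]_(k, t + u)) :
  row_free (lsubmx D) -> row_free D.
Proof.
move=> fD; apply: inj_row_free => y; rewrite -[D]hsubmxK mul_mx_row => /eqP.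
by rewrite row_mx_eq0 mulmx_free_eq0 // => /andP[/eqP].
Qed.

End RowFreeBlocks.

(** Multiplying on the left and on the right by invertible matrices that carry one frame to another
    gives a bijection. *)
Lemma card_row_free_fiber (F : finFieldType) (k n : nat)
    (X Y X0 Y0 : 'M[F]_(k, n)) :
  row_free X -> row_free Y -> row_free X0 -> row_free Y0 ->
  #|[set g : 'M[F]_n | (g \in unitmx) && (X *m g == Y)]|
  = #|[set g : 'M[F]_n | (g \in unitmx) && (X0 *m g == Y0)]|.
Proof.
move=> fX fY fX0 fY0.
have [h hu X0E] := row_free_transitive fX0 fX.
have [j ju YE] := row_free_transitive fY fY0.
have inj : injective (fun g : 'M[F]_n => h *m g *m j).
  by apply: (can_inj (g := fun g => invmx h *m (g *m invmx j))) => g;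
    rewrite mulmxK // mulKmx.
rewrite -[RHS](card_preimset _ inj); apply: eq_card => g; rewrite !inE.
rewrite !unitmx_mul hu ju andbT /= !mulmxA X0E -YE; congr (_ && _).
have fj : row_free j by rewrite row_free_unit.
by apply/eqP/eqP => [-> // | /(row_free_inj fj)].
Qed.

Section Elliptic.

Variables (F : finFieldType) (n : nat) (c : 'M[F]_n).
Hypothesis n_gt0 : (0 < n)%N.
Hypothesis c_ell : regular_elliptic c.
Let q : rat := #|F|%:R.

Let c_unit : c \in unitmx. Proof. by case: c_ell. Qed.

(** The fixed space of [c] is stable, so it is zero or everything. In the second case [c = 1]
    stabilizes every line, so [n = 1], which is excluded. *)
Lemma regular_elliptic_sub1_unit : c - 1%:M \in unitmx.
Proof.
case: c_ell => _ irr c1; rewrite -row_free_unit -kermx_eq0.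
have /irr/orP[// | ] : stablemx (kermx (c - 1%:M)) c.
  have : kermx (c - 1%:M) *m (c - 1%:M) = 0 by exact: mulmx_ker.
  by move/eqP; rewrite mulmxBr mulmx1 subr_eq0 => /eqP ->.
rewrite /row_full mxrank_ker => /eqP rc.
have cE : c = 1%:M.
  apply/eqP; rewrite -subr_eq0 -mxrank_eq0.
  by rewrite -(subKn (rank_leq_row (c - 1%:M))) rc subnn.
have n1 : n != 1%N by apply/eqP => /c1.
have /irr : stablemx (pid_mx 1 : 'M[F]_n) c by rewrite cE mulmx1.
by rewrite -mxrank_eq0 /row_full rank_pid_mx //= => /eqP h; rewrite -h eqxx in n1.
Qed.

(** The first factor [g] determines the second one, [v = g^-1 c], and [v - 1 = g^-1 (c - g)] has the
    rank of [g - c]. *)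
Lemma pair_countE r s : pair_count c r s =
  #|[set g : 'M[F]_n | [&& g \in unitmx, (n - \rank (g - 1%:M)%R == r)%N
                         & (n - \rank (g - c)%R == s)%N]]|.
Proof.
pose f (g : 'M[F]_n) := (g, invmx g *m c).
rewrite -(@card_imset _ _ f); last by move=> g h [].
apply: eq_card => -[g v]; rewrite !inE /fixdim !mxrank_ker /=.
have rankE (h : 'M[F]_n) : h \in unitmx ->
    \rank (invmx h *m c - 1%:M) = \rank (h - c)%R.
  move=> hu; have -> : invmx h *m c - 1%:M = invmx h *m (c - h).
    by rewrite mulmxBr mulVmx.
  rewrite eqmxMfull ?row_full_unit ?unitmx_inv //.
  by rewrite -opprB eqmx_opp.
apply/and5P/imsetP => [[gu vu /eqP gvE gr vs] | [g' ] ].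
  have vE : v = invmx g *m c by rewrite -gvE mulKmx.
  by exists g; rewrite ?inE ?gu ?gr -?rankE // ?vE // -vE vs.
rewrite inE => /and3P[gu gr gs] [-> ->].
split=> //=; first by rewrite unitmx_mul unitmx_inv gu c_unit.
  by rewrite mulKVmx.
by rewrite rankE.
Qed.

Lemma sum_pair_count (f : nat -> nat -> rat) :
  \sum_(r < n.+1) \sum_(s < n.+1) (pair_count c r s)%:R * f r s
  = \sum_(g : 'M[F]_n | g \in unitmx)
      f (n - \rank (g - 1%:M)%R)%N (n - \rank (g - c)%R)%N.
Proof.
pose p1 (g : 'M[F]_n) : 'I_n.+1 := inord (n - \rank (g - 1%:M)%R).
pose p2 (g : 'M[F]_n) : 'I_n.+1 := inord (n - \rank (g - c)%R).
rewrite (partition_big p1 xpredT) //=; apply: eq_bigr => r _.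
rewrite (partition_big p2 xpredT) //=; apply: eq_bigr => s _.
have p1E g (i : 'I_n.+1) : (p1 g == i) = (n - \rank (g - 1%:M)%R == i)%N.
  by rewrite -val_eqE /= inordK // ltnS leq_subr.
have p2E g (i : 'I_n.+1) : (p2 g == i) = (n - \rank (g - c)%R == i)%N.
  by rewrite -val_eqE /= inordK // ltnS leq_subr.
rewrite pair_countE -sum1_card natr_sum mulr_suml.
apply: eq_big => g; rewrite inE; first by rewrite p1E p2E andbA.
by case/and3P => _ /eqP -> /eqP ->; rewrite mul1r.
Qed.

Section Blocks.

Variables t u : nat.

(** The frames A and B are stacked in one matrix [X], so that [A g = A] and [B g = B c] become
    [X *m g = twist X]. *)
Definition twist (X : 'M[F]_(t + u, n)) : 'M[F]_(t + u, n) :=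
  col_mx (usubmx X) (dsubmx X *m c).

(* [fall q (q ^+ d) t] is the number of [t]-frames of a space of dimension [d],
   so this is the number of triples [(g, A, B)] with [A g = A], [B g = B c]. *)
Definition frame_count : rat :=
  \sum_(g : 'M[F]_n | g \in unitmx)
    fall q (q ^+ (n - \rank (g - 1%:M)%R)) t * fall q (q ^+ (n - \rank (g - c)%R)) u.

(* [A g = A] and [B g = B c] force the rows of [A] and [B] to be independent
   altogether, as [c] has no nonzero fixed vector. *)
Lemma twist_row_free (g : 'M[F]_n) (X : 'M[F]_(t + u, n)) : g \in unitmx ->
  row_free (usubmx X) -> row_free (dsubmx X) -> X *m g = twist X -> row_free X.
Proof.
move=> gu fA fB XgE; apply: inj_row_free => y yX0.
have : y *m X *m g = 0 by rewrite yX0 mul0mx.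
rewrite -mulmxA XgE; move: yX0; rewrite -{1}[X]vsubmxK -[y]hsubmxK !mul_row_col.
set a := _ *m usubmx X; move/eqP; rewrite addr_eq0 => /eqP aE; rewrite aE mulmxA.
move/eqP; rewrite addrC -[X in _ - X]mulmx1 -mulmxBr.
rewrite mulmx_free_eq0 ?row_free_unit ?regular_elliptic_sub1_unit // => /eqP b0.
move/eqP: b0 (aE); rewrite mulmx_free_eq0 // => /eqP ->.
rewrite mul0mx oppr0 => /eqP; rewrite mulmx_free_eq0 // => /eqP ->.
by rewrite row_mx0.
Qed.

(** For fixed [g], A and B are chosen independently in the kernels of [g - 1] and [g - c];
    exchanging the sums groups the triples by [X] instead. *)
Lemma frame_countE : frame_count =
  (\sum_(X : 'M[F]_(t + u, n) | row_free X)
     #|[set g : 'M[F]_n | (g \in unitmx) && (X *m g == twist X)]|)%:R.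
Proof.
rewrite /frame_count natr_sum.
under [RHS]eq_bigr => X _ do rewrite -sum1_card natr_sum.
rewrite [RHS](exchange_big_dep (mem unitmx)) /=; last first.
  by move=> X g _; rewrite inE => /andP[].
apply: eq_bigr => g gu.
rewrite -!mxrank_ker -!card_row_free_sub -natrM -cardsX -natr_sum; congr (_%:R).
rewrite -sum1_card.
rewrite (reindex (fun X : 'M[F]_(t + u, n) => (usubmx X, dsubmx X))) /=; last first.
  exists (fun p => col_mx p.1 p.2) => [X | [a b]] _ /=; first exact: vsubmxK.
  by rewrite col_mxKu col_mxKd.
apply: eq_bigl => X; rewrite !inE gu /=.
have fixE (m : nat) (A : 'M[F]_(m, n)) (h : 'M_n) :
    (A <= kermx (g - h))%MS = (A *m g == A *m h).
  by rewrite -subr_eq0 -mulmxBr; apply/sub_kermxP/eqP.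
rewrite !fixE mulmx1.
have -> : (X *m g == twist X)
    = (usubmx X *m g == usubmx X) && (dsubmx X *m g == dsubmx X *m c).
  rewrite -{1}[X]vsubmxK mul_col_mx; apply/eqP/andP => [/eq_col_mx[-> ->] //|].
  by case=> /eqP -> /eqP ->.
apply/andP/and3P => [[/andP[fA AE] /andP[fB BE]] | [fX AE BE]].
  split=> //; apply: (twist_row_free gu) => //.
  by rewrite -{1}[X]vsubmxK mul_col_mx (eqP AE) (eqP BE).
by rewrite AE BE row_free_usubmx // row_free_dsubmx.
Qed.

Lemma frame_count_big : (n < t + u)%N -> frame_count = 0.
Proof.
move=> ntu; rewrite frame_countE big_pred0 // => X; apply/negbTE/negP => /eqP fX.
by have := rank_leq_col X; rewrite fX leqNgt ntu.
Qed.

Hypothesis tun : (t + u <= n)%N.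

Let X0 : 'M[F]_(t + u, n) := pid_mx (t + u).

Let fX0 : row_free X0.
Proof. by rewrite /row_free rank_pid_mx. Qed.

(** If [twist X] is free, there are as many [g] with [X *m g = twist X] as [E] with [X0 *m E = X];
    otherwise there is no such [g]. *)
Lemma frame_count_basis : frame_count =
  #|[set E : 'M[F]_n | (E \in unitmx) && row_free (twist (X0 *m E))]|%:R.
Proof.
rewrite frame_countE; congr (_%:R); rewrite -[RHS]sum1_card.
rewrite (partition_big (fun E : 'M[F]_n => X0 *m E) (fun X => row_free X)) /=;
  last first.
  by move=> E; rewrite inE => /andP[Eu _]; rewrite row_free_mulmx_unit.
apply: eq_bigr => X fX; have [ftX | nftX] := boolP (row_free (twist X)).
  rewrite (card_row_free_fiber fX ftX fX0 fX) -sum1_card; apply: eq_bigl => E.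
  rewrite !inE; case: eqP => [-> | _]; first by rewrite ftX !andbT.
  by rewrite !andbF.
rewrite big_pred0 => [|E]; last first.
  rewrite !inE; case: eqP => [-> | _]; last by rewrite andbF.
  by rewrite (negPf nftX) andbF.
apply/eqP; rewrite cards_eq0; apply/eqP/setP => g; rewrite !inE.
apply/negbTE/negP => /andP[gu /eqP XgE].
by move: nftX; rewrite -XgE row_free_mulmx_unit // fX.
Qed.

(** The two blocks of [twist (X0 *m E)] are each row free, so the relation forces the two blocks of
    [D] to have the same left kernel, which is then that of [D]. *)
Lemma row_free_ker_twist (w : nat) (D : 'M[F]_(w, t + u)) (E : 'M[F]_n) :
  E \in unitmx -> D *m twist (X0 *m E) = 0 ->
  row_free D = row_free (lsubmx D) && row_free (rsubmx D).
Proof.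
move=> Eu; rewrite -{1}[D]hsubmxK mul_row_col.
have fXE : row_free (X0 *m E) by rewrite row_free_mulmx_unit.
have fA := row_free_usubmx fXE.
have fB : row_free (dsubmx (X0 *m E) *m c).
  by rewrite row_free_mulmx_unit // row_free_dsubmx.
set A := usubmx _ in fA *; set B := dsubmx _ *m c in fB *.
move/eqP; rewrite addr_eq0 => /eqP DE.
apply/idP/andP => [fD | [/row_free_lsubmx //]].
have ker0 (y : 'rV_w) : y *m lsubmx D = 0 \/ y *m rsubmx D = 0 -> y = 0.
  move=> h; apply/eqP; rewrite -(mulmx_free_eq0 y fD).
  rewrite -[D]hsubmxK mul_mx_row row_mx_eq0.
  rewrite -(mulmx_free_eq0 _ fA) -[X in _ && X](mulmx_free_eq0 _ fB).
  have := congr1 (mulmx y) DE; rewrite mulmxN !mulmxA.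
  case: h => ->; rewrite !mul0mx ?oppr0 eqxx ?andbT.
    by move/esym/eqP; rewrite oppr_eq0.
  by move=> ->; rewrite eqxx.
by split; apply: inj_row_free => y yD; apply: ker0; [left | right].
Qed.

Lemma card_row_free (k m : nat) :
  #|[set a : 'M[F]_(k, m) | row_free a]|%:R = fall q (q ^+ m) k.
Proof.
rewrite -[in q ^+ m](@mxrank1 F m) -card_row_free_sub; congr (_%:R).
by apply: eq_card => a; rewrite !inE submx1 andbT.
Qed.

(** Count the pairs [(E, D)] by [D]: both blocks of [D] are free, and the relations say that [c]
    maps [w] prescribed combinations of the rows of [E] to [w] others, so [card_intertwining] gives
    the same number for every [D]. *)
Lemma sum_card_ker_twist (w : nat) :
  \sum_(E : 'M[F]_n | E \in unitmx)
     #|[set D : 'M[F]_(w, t + u) |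
          row_free D && (D <= kermx (twist (X0 *m E)))%MS]|%:R
  = fall q (q ^+ t) w * fall q (q ^+ u) w
    * ((q ^+ n - 1) * \prod_(w.+1 <= i < n) (q ^+ n - q ^+ i)) :> rat.
Proof.
pose K E := [set D : 'M[F]_(w, t + u) |
  row_free D && (D <= kermx (twist (X0 *m E)))%MS].
transitivity (\sum_(E : 'M[F]_n | E \in unitmx) \sum_(D in K E) (1 : rat)).
  by apply: eq_bigr => E _; rewrite sumr_const.
pose S := [set D : 'M[F]_(w, t + u) | row_free (lsubmx D) && row_free (rsubmx D)].
rewrite (exchange_big_dep (mem S)) /=; last first.
  move=> E D Eu; rewrite !inE => /andP[fD /sub_kermxP DE].
  by rewrite -(row_free_ker_twist Eu DE).
rewrite (eq_bigr (fun _ => (q ^+ n - 1)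
    * \prod_(w.+1 <= i < n) (q ^+ n - q ^+ i))); last first.
  move=> D; rewrite inE => /andP[fZ fW].
  have [_ irr _] := c_ell.
  rewrite -(card_intertwining n_gt0 irr (D1 := rsubmx D *m dsubmx X0)
              (D2 := - (lsubmx D *m usubmx X0))); last first.
    apply: inj_row_free => y; rewrite -[y]hsubmxK mul_row_col mulmxN.
    set y1 := lsubmx y; set y2 := rsubmx y => yE.
    have /eqP : row_mx (- (y2 *m lsubmx D)) (y1 *m rsubmx D) *m X0 = 0.
      by rewrite -[X0]vsubmxK mul_row_col mulNmx addrC -!mulmxA.
    rewrite mulmx_free_eq0 // row_mx_eq0 oppr_eq0 !mulmx_free_eq0 //.
    by case/andP => /eqP -> /eqP ->; rewrite row_mx0.
  rewrite -sum1_card natr_sum; apply: eq_bigl => E.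
  rewrite !inE; case: (boolP (E \in unitmx)) => //= Eu.
  rewrite row_free_lsubmx //=.
  have -> : (D <= kermx (twist (X0 *m E)))%MS = (D *m twist (X0 *m E) == 0).
    by apply/sub_kermxP/eqP.
  rewrite -{1}[D]hsubmxK mul_row_col -!mul_usub_mx -!mul_dsub_mx.
  by rewrite addrC addr_eq0 eq_sym mulNmx !mulmxA.
rewrite sumr_const -mulr_natl; congr (_ * _).
rewrite -!card_row_free -natrM -cardsX; congr (_%:R).
have inj : injective (fun p : 'M[F]_(w, t) * 'M[F]_(w, u) => row_mx p.1 p.2).
  by move=> [a b] [a' b'] /= /eq_row_mx[-> ->].
rewrite -(card_imset _ inj); apply: eq_card => D; rewrite inE.
apply/andP/imsetP => [[fZ fW] | [[a b]]].
  by exists (lsubmx D, rsubmx D); rewrite ?inE ?fZ ?fW ?hsubmxK.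
by rewrite !inE => /andP[fa fb] ->; rewrite row_mxKl row_mxKr.
Qed.

Let q_gt1 : 1 < q.
Proof. by rewrite ltr1n finNzRing_gt1. Qed.

(** By [qbin_mobius], the indicator of a zero kernel is an alternating sum over its [w]-dimensional
    subspaces; their number is that of [w]-frames divided by [fall q (q ^+ w) w]. *)
Lemma frame_count_mobius : frame_count =
  \sum_(w < (t + u).+1) mobius_coef q w * qbin q (q ^+ u) w * fall q (q ^+ t) w
    * ((q ^+ n - 1) * \prod_(w.+1 <= i < n) (q ^+ n - q ^+ i)).
Proof.
rewrite frame_count_basis -sum1_card natr_sum.
transitivity (\sum_(E : 'M[F]_n | E \in unitmx) \sum_(w < (t + u).+1)
   mobius_coef q w / fall q (q ^+ w) w
   * #|[set D : 'M[F]_(w, t + u) |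
          row_free D && (D <= kermx (twist (X0 *m E)))%MS]|%:R).
  rewrite (eq_bigl (fun E => (E \in unitmx) && row_free (twist (X0 *m E))));
    last by move=> E; rewrite inE.
  rewrite big_mkcondr; apply: eq_bigr => E Eu.
  set R := twist _.
  have -> : (if row_free R then 1 else 0) = (t + u - \rank R == 0)%N%:R :> rat.
    rewrite subn_eq0 /row_free eqn_leq rank_leq_row /=.
    by case: (t + u <= \rank R)%N.
  rewrite -(qbin_mobius q_gt1 (leq_subr (\rank R) (t + u))).
  apply: eq_bigr => w _; rewrite card_row_free_sub mxrank_ker.
  by rewrite /qbin mulrA mulrAC.
rewrite exchange_big; apply: eq_bigr => w _; rewrite -mulr_sumr sum_card_ker_twist.
rewrite /qbin; ring.
Qed.

Lemma GLcard_prod : (GLcard F n)%:R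
  = (q ^+ n - 1) * \prod_(1 <= i < n) (q ^+ n - q ^+ i) :> rat.
Proof.
rewrite GLcardE /fall -(big_mkord xpredT (fun i => q ^+ n - q ^+ i)).
by rewrite big_ltn // expr0.
Qed.

(** The terms with [w > u] vanish. In the others, [q ^+ n - 1] and the factors of index above [u]
    cancel against the order of G. *)
Lemma frame_count_qvander : (u < n)%N -> frame_count / (GLcard F n)%:R =
  qvander q u (q ^+ t) (q ^+ n) / \prod_(i < u) (q ^+ n - q ^+ i.+1).
Proof.
move=> un.
have GL0 : (GLcard F n)%:R != 0 :> rat.
  by rewrite GLcardE fall_expq_neq0.
have GLE : (GLcard F n)%:R = (q ^+ n - 1) * \prod_(i < u) (q ^+ n - q ^+ i.+1)
     * \prod_(u.+1 <= i < n) (q ^+ n - q ^+ i) :> rat.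
  rewrite GLcard_prod (big_cat_nat (n := u.+1)) //= big_add1 /= big_mkord.
  by rewrite mulrA.
have P0 : \prod_(i < u) (q ^+ n - q ^+ i.+1) != 0.
  by apply: contraNneq GL0 => P0; rewrite GLE P0 mulr0 mul0r.
apply: (canRL (mulfK P0)).
rewrite mulrAC; apply: (canLR (mulfK GL0)).
rewrite frame_count_mobius (addnC t u) -addSn big_split_ord /=.
rewrite [X in _ + X]big1 ?addr0 => [|w _]; last first.
  by rewrite qbin_small ?mulr0 ?mul0r // addSn ltnS leq_addr.
rewrite /qvander mulr_suml mulr_suml; apply: eq_bigr => w _.
have wu : (w <= u)%N by rewrite -ltnS.
have un' : (u.+1 <= n)%N by [].
rewrite GLE (big_cat_nat (n := u.+1)) //= big_add1 /=.
have := P0; move: (\prod_(i < u) _) => p p0.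
by field.
Qed.

End Blocks.

(** * The generating function in the basis of q-shifted factorials *)

Definition frame_coef t u : rat := frame_count t u / (GLcard F n)%:R.

Let q_gt1 : 1 < q.
Proof. by rewrite ltr1n finNzRing_gt1. Qed.

Lemma GLcard_neq0 : (GLcard F n)%:R != 0 :> rat.
Proof. by rewrite GLcardE fall_expq_neq0. Qed.

Lemma frame_coef_big t u : (n < t + u)%N -> frame_coef t u = 0.
Proof. by move=> h; rewrite /frame_coef frame_count_big // mul0r. Qed.

(** An instance of Burnside's lemma: G is transitive on [t]-frames, so its elements fix one of them
    on average. *)
Lemma frame_coef_t0 t : (t <= n)%N -> frame_coef t 0 = 1.
Proof.
move=> tn; rewrite /frame_coef frame_count_qvander ?addn0 //.
by rewrite big_ord0 divr1 /qvander big_ord1 qbin0 fall0 big_geq //.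
Qed.

(** As [u = n] is allowed, [frame_count_qvander] does not apply; in the Moebius sum only [w = 0]
    survives. *)
Lemma frame_coef_0u u : (u <= n)%N -> frame_coef 0 u = 1.
Proof.
move=> un; rewrite /frame_coef frame_count_mobius //.
rewrite big_ord_recl [X in _ + X]big1 ?addr0 => [|w _]; last first.
  by rewrite lift0 [fall _ (q ^+ 0) _]fall_small ?mulr0 ?mul0r.
rewrite qbin0 fall0 /mobius_coef bin0n !mulr1 mul1r -GLcard_prod.
by rewrite divff ?GLcard_neq0.
Qed.

(** Expand [x ^+ r] and [y ^+ s] by [expr_qpoch_inv] and sum over [r], [s] first: by
    [sum_pair_count] the inner sum is [frame_count]. *)
Lemma frame_generating_function (x y : {poly {poly rat}}) :
  \sum_(r < n.+1) \sum_(s < n.+1)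
     (((pair_count c r s)%:R / (GLcard F n)%:R : rat)%:P%:P * x ^+ r * y ^+ s)
  = \sum_(t < n.+1) \sum_(u < n.+1)
     (frame_coef t u / (qpoch q t * qpoch q u))%:P%:P
       * qpoch_inv q x t * qpoch_inv q y u.
Proof.
pose a r s : rat := (pair_count c r s)%:R / (GLcard F n)%:R.
pose b r t : rat := fall q (q ^+ r) t / qpoch q t.
transitivity (\sum_(r < n.+1) \sum_(s < n.+1) \sum_(t < n.+1) \sum_(u < n.+1)
   (a r s * (b r t * b s u))%:P%:P * (qpoch_inv q x t * qpoch_inv q y u)).
  apply: eq_bigr => r _; apply: eq_bigr => s _.
  rewrite (expr_qpoch_inv q_gt1 x (leq_ord r)) (expr_qpoch_inv q_gt1 y (leq_ord s)).
  rewrite -mulrA mulr_suml mulr_sumr; apply: eq_bigr => t _.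
  rewrite mulr_sumr mulr_sumr; apply: eq_bigr => u _.
  by rewrite !polyCM; ring.
under eq_bigr => r _ do rewrite exchange_big.
rewrite exchange_big; apply: eq_bigr => t _ /=.
under eq_bigr => r _ do rewrite exchange_big.
rewrite exchange_big; apply: eq_bigr => u _ /=.
under eq_bigr => r _ do rewrite -mulr_suml -!rmorph_sum.
rewrite -mulr_suml -!rmorph_sum -mulrA; congr (_%:P%:P * _).
rewrite /frame_coef /frame_count.
rewrite -(sum_pair_count (fun r s => fall q (q ^+ r) t * fall q (q ^+ s) u)).
rewrite !mulr_suml; apply: eq_bigr => r _; rewrite !mulr_suml.
apply: eq_bigr => s _; rewrite /a /b.
by rewrite invfM; ring.
Qed.

End Elliptic.

Theorem theorem1p2 (F : finFieldType) (n : nat) (c : 'M[F]_n) :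
  (0 < n)%N -> regular_elliptic c ->
  let q : rat := (#|F|)%:R in
  let x : {poly {poly rat}} := 'X%:P in
  let y : {poly {poly rat}} := 'X in
  \sum_(r < n.+1) \sum_(s < n.+1)
     (((pair_count c r s)%:R / (GLcard F n)%:R : rat)%:P%:P * x ^+ r * y ^+ s)
  = qpoch_inv q x n * ((qpoch q n)^-1)%:P%:P
    + qpoch_inv q y n * ((qpoch q n)^-1)%:P%:P
    + \sum_(t < n) \sum_(u < n | (t + u <= n)%N)
        ((q ^ ((t * u)%:Z - t%:Z - u%:Z)
          * (qfact q (n - t - 1) * qfact q (n - u - 1))
            / (qfact q (n - 1) * qfact q (n - t - u))
          * ((q ^+ n - q ^+ t - q ^+ u + 1) / (q - 1))
          / (qpoch q t * qpoch q u))%:P%:P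
         * qpoch_inv q x t * qpoch_inv q y u).
Proof.
move=> n0 c_ell q x y.
have q1 : 1 < q by rewrite ltr1n finNzRing_gt1.
rewrite frame_generating_function // -/q.
pose T t u : {poly {poly rat}} := (frame_coef c t u / (qpoch q t * qpoch q u))%:P%:P
       * qpoch_inv q x t * qpoch_inv q y u.
have p0 : qpoch q 0 = 1 by rewrite /qpoch big_ord0.
have P0 z : qpoch_inv q z 0 = 1 by rewrite /qpoch_inv big_ord0.
have Tn0 : T n 0%N = qpoch_inv q x n * ((qpoch q n)^-1)%:P%:P.
  by rewrite /T frame_coef_t0 // p0 P0 !mulr1 mul1r mulrC.
have T0n : T 0%N n = qpoch_inv q y n * ((qpoch q n)^-1)%:P%:P.
  by rewrite /T frame_coef_0u // p0 P0 mulr1 !mul1r mulrC.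
have Tbig t u : (n < t + u)%N -> T t u = 0.
  by move=> h; rewrite /T frame_coef_big // mul0r !polyC0 !mul0r.
(* As [T t u = 0] for [t + u > n], the row [t = n] reduces to [u = 0] and the column [u = n] to
   [t = 0]; these are the two separate terms. *)
rewrite big_ord_recr /= addrC [RHS]addrAC -[RHS]addrA -Tn0; congr (_ + _).
  rewrite (big_ord_recl n) big1 ?addr0 // => u _.
  by rewrite -/(T n (lift ord0 u)) Tbig // lift0 addnS ltnS leq_addr.
under eq_bigr => t _ do rewrite big_ord_recr /=.
rewrite big_split /= -T0n; congr (_ + _).
  apply: eq_bigr => t _; rewrite [LHS](bigID (fun u : 'I_n => (t + u <= n)%N)) /=.
  rewrite [X in _ + X]big1 ?addr0 => [|u]; last first.
    by rewrite -ltnNge => /Tbig.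
  apply: eq_bigr => u tun; rewrite -(qvander_coef q1) //.
  by rewrite -(frame_count_qvander n0 c_ell tun (ltn_ord u)).
rewrite (bigD1 (Ordinal n0)) //= big1 ?addr0 // => t t0.
by apply: Tbig; rewrite -[X in (X < _)%N]add0n ltn_add2r lt0n.
Qed.
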